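(* Let $k_1,k_2,k_3>0$, $n,j\in\mathbb Z_{\ge0}$, $r\in\mathbb Z$ and $\rho,\tau\in\mathbb R$. The continuous dual Hahn polynomials satisfy the generalized convolution identity $$\sum_{l=0}^{n+j}\binom{n+j}{l}(2k_1)_j\,T_l(j;2k_1-1,2k_2-1,n+j)\;S_{n+j-l}(\rho;k_2-k_3+\tfrac12,k_2+k_3-\tfrac12,k_3-k_2+l+r+\tfrac12)\;S_l(\tau;k_1+i\rho,k_1-i\rho,k_3-k_2-k_1+r+\tfrac12)$$ $$=W_j(\rho;k_2-k_3+\tfrac12,k_2+k_3-\tfrac12,k_1+i\tau,k_1-i\tau)\;S_n(\tau;k_1+k_2-k_3+j+\tfrac12,k_1+k_2+k_3+j-\tfrac12,k_3-k_2-k_1+r+\tfrac12).$$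
   Context: $(a)_n=a(a+1)\cdots(a+n-1)$ is the Pochhammer symbol. Dual Hahn polynomials: for $0\le l,j\le N$, $T_l(j;\gamma,\delta,N)={}_3F_2\left(-l,-j,j+\gamma+\delta+1;\gamma+1,-N;1\right)$ (the sum being over indices $0\le i\le\min(l,j)$). Continuous dual Hahn polynomials: $S_n(x;a,b,c)=(a+b)_n(a+c)_n\,{}_3F_2\left(-n,a+ix,a-ix;a+b,a+c;1\right)$, a polynomial in $x^2,a,b,c$, symmetric in $a,b,c$ (products with vanishing lower parameters are understood as this polynomial). Wilson polynomials: $W_n(x;a,b,c,d)=(a+b)_n(a+c)_n(a+d)_n\,{}_4F_3\left(-n,n+a+b+c+d-1,a+ix,a-ix;a+b,a+c,a+d;1\right)$, likewise a polynomial, symmetric in $a,b,c,d$. *)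

(* Defs.v *)
From HB Require Import structures.
From mathcomp Require Import all_boot all_order all_algebra.
From mathcomp Require Import complex reals.
Set Implicit Arguments.
Unset Strict Implicit.
Unset Printing Implicit Defensive.
Import Order.TTheory GRing.Theory Num.Theory.
Local Open Scope ring_scope.

(* The Pochhammer symbol (a)_n. *)
Definition poch (F : fieldType) (a : F) (n : nat) : F :=
  \prod_(i < n) (a + i%:R).

(* The hypergeometric series pFq(s; t; z) summed over 0 <= i <= m.  It is
   only meant for terminating series, cut at their last nonzero term. *)
Definition hypergeom (F : fieldType) (m : nat) (s t : seq F) (z : F) : F :=
  \sum_(i < m.+1)
    (\prod_(a <- s) poch a i) / (\prod_(b <- t) poch b i) * (z ^+ i / i`!%:R).

(* T_l(j; gamma, delta, N), for l, j <= N. *)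
Definition dual_hahn (F : fieldType) (l j : nat) (gamma delta : F) (N : nat)
    : F :=
  hypergeom (minn l j) [:: - l%:R; - j%:R; j%:R + gamma + delta + 1]
    [:: gamma + 1; - N%:R] 1.

(* S_n(x; a, b, c) as a polynomial: the prefactor (a+b)_n (a+c)_n has been
   distributed over the sum, using (u)_n / (u)_i = (u+i)_{n-i}, so that the
   definition also makes sense when a lower parameter vanishes; see
   [cdual_hahn_hypergeom]. *)
Definition cdual_hahn (C : numClosedFieldType) (n : nat) (x a b c : C) : C :=
  \sum_(i < n.+1)
    poch (- n%:R) i * poch (a + 'i * x) i * poch (a - 'i * x) i
    * (poch (a + b + i%:R) (n - i) * poch (a + c + i%:R) (n - i)) / i`!%:R.

(* W_n(x; a, b, c, d), with the same convention; see [wilson_hypergeom]. *)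
Definition wilson (C : numClosedFieldType) (n : nat) (x a b c d : C) : C :=
  \sum_(i < n.+1)
    poch (- n%:R) i * poch (n%:R + a + b + c + d - 1) i
    * poch (a + 'i * x) i * poch (a - 'i * x) i
    * (poch (a + b + i%:R) (n - i) * poch (a + c + i%:R) (n - i)
       * poch (a + d + i%:R) (n - i)) / i`!%:R.

Lemma poch_split (F : fieldType) (a : F) (n i : nat) :
  (i <= n)%N -> poch a n = poch a i * poch (a + i%:R) (n - i).
Proof.
move=> le_in; move: (n - i)%N (subnKC le_in) => m <-.
rewrite /poch big_split_ord /=.
by congr (_ * _); apply: eq_bigr => k _; rewrite natrD addrA.
Qed.

Lemma poch_ratio (F : fieldType) (a : F) (n i : nat) :
  poch a n != 0 -> (i <= n)%N ->
  poch (a + i%:R) (n - i) = poch a n / poch a i.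
Proof.
move=> nz le_in; move: nz; rewrite (poch_split a le_in) mulf_eq0 negb_or.
by case/andP=> nz _; rewrite mulrC mulKf.
Qed.

Lemma cdual_hahn_hypergeom (C : numClosedFieldType) (n : nat) (x a b c : C) :
  poch (a + b) n != 0 -> poch (a + c) n != 0 ->
  cdual_hahn n x a b c =
    poch (a + b) n * poch (a + c) n
    * hypergeom n [:: - n%:R; a + 'i * x; a - 'i * x] [:: a + b; a + c] 1.
Proof.
move=> nzb nzc; rewrite /cdual_hahn /hypergeom mulr_sumr.
apply: eq_bigr => i _; have le_in : (i <= n)%N by rewrite -ltnS.
rewrite !(poch_ratio _ le_in) // !big_cons !big_nil !mulr1 expr1n mul1r.
rewrite invfM !mulrA; congr (_ / _).
by rewrite [RHS](ACl (3*4*5*1*6*2*7))%AC.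
Qed.

Lemma wilson_hypergeom (C : numClosedFieldType) (n : nat) (x a b c d : C) :
  poch (a + b) n != 0 -> poch (a + c) n != 0 -> poch (a + d) n != 0 ->
  wilson n x a b c d =
    poch (a + b) n * poch (a + c) n * poch (a + d) n
    * hypergeom n
        [:: - n%:R; n%:R + a + b + c + d - 1; a + 'i * x; a - 'i * x]
        [:: a + b; a + c; a + d] 1.
Proof.
move=> nzb nzc nzd; rewrite /wilson /hypergeom mulr_sumr.
apply: eq_bigr => i _; have le_in : (i <= n)%N by rewrite -ltnS.
rewrite !(poch_ratio _ le_in) // !big_cons !big_nil !mulr1 expr1n mul1r.
rewrite !invfM !mulrA; congr (_ / _).
by rewrite [RHS](ACl (4*5*6*7*1*8*2*9*3*10))%AC.
Qed.

(* Main.v *)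
(* With a = k2 - k3 + 1/2, b = k2 + k3 - 1/2 and c = 1 - a + r, both sides are
   functions of the integer r.  The forward difference of S_n(x; a, b, c) in c
   is n (a + b + n - 1) S_(n-1)(x; a, b, c + 1), so the difference of the right
   hand side in r is a multiple of the right hand side for n - 1 at r + 1.  A
   contiguous relation of the dual Hahn weights gives the same recurrence for
   the left hand side; hence, by induction on n, the two sides differ by a
   constant in r.  At r = -(n + j) the polynomials S_(n+j-l) and S_n on both
   sides reduce to single products, and expanding S_l from its third parameter
   turns the left hand side into the defining sum of W_j after a binomial
   inversion and the Chu-Vandermonde summation. *)
Require Import Defs.
From mathcomp Require Import all_boot all_order all_algebra.
From mathcomp Require Import complex reals.
From mathcomp Require Import ring zify.
Import Order.TTheory GRing.Theory Num.Theory.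
Local Open Scope ring_scope.
Local Open Scope complex_scope.

Set Implicit Arguments.
Unset Strict Implicit.

(** * Binomial coefficient identities *)

Lemma mul_bin_bin (n k i : nat) : (i <= k)%N -> (k <= n)%N ->
  ('C(n, i) * 'C(n - i, k - i) = 'C(n, k) * 'C(k, i))%N.
Proof.
move=> ik kn; have ni := leq_trans ik kn.
have := bin_fact ni; have := bin_fact kn; have := bin_fact ik.
have := @bin_fact (n - i) (k - i) (leq_sub2r _ kn).
have -> : (n - i - (k - i) = n - k)%N by rewrite subnBA // subnK.
move=> e1 e2 e3 e4.
apply/eqP; rewrite -(@eqn_pmul2r (i`! * (k - i)`! * (n - k)`!))
  ?muln_gt0 ?fact_gt0 //.
apply/eqP; transitivity n`!.
  by rewrite -e4 -e1; ring.
by rewrite -e3 -e2; ring.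
Qed.

(** Serves to simplify the quotient of (-l)_q by (-N)_q in the dual Hahn sum; both sides vanish when
    l < q. *)
Lemma ffact_mul_bin (N l q : nat) : (q <= N)%N -> (l <= N)%N ->
  ('C(N, l) * l ^_ q = N ^_ q * 'C(N - q, N - l))%N.
Proof.
move=> qN lN; case: (leqP q l) => [ql|lq]; last first.
  by rewrite ffact_small // (@bin_small (N - q)) ?muln0 //; lia.
have <- : 'C(N - q, l - q) = 'C(N - q, N - l).
  by rewrite -bin_sub ?leq_sub2r //; congr binomial; lia.
by rewrite -!bin_ffact mulnA -mul_bin_bin // mulnAC.
Qed.

Lemma big_triangle (V : nmodType) (n : nat) (F : nat -> nat -> V) :
  \sum_(i < n.+1) \sum_(v < (n - i).+1) F i v
  = \sum_(k < n.+1) \sum_(i < k.+1) F i (k - i)%N.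
Proof.
elim: n => [|n IHn]; first by rewrite !big_ord1.
rewrite big_ord_recr [RHS]big_ord_recr /= subnn big_ord1.
rewrite [X in _ = _ + X]big_ord_recr /= subnn addrA -IHn; congr (_ + _).
rewrite -big_split; apply: eq_bigr => i _ /=.
by rewrite subSn ?leq_ord // big_ord_recr.
Qed.

Section Pascal.
Variable R : comPzRingType.

Lemma sum_binS (n : nat) (F : nat -> R) :
  \sum_(k < n.+2) 'C(n.+1, k)%:R * F k
  = \sum_(k < n.+1) 'C(n, k)%:R * (F k + F k.+1).
Proof.
rewrite big_ord_recl /= bin0.
under eq_bigr => i _ do rewrite /bump /= add1n binS natrD mulrDl.
under [RHS]eq_bigr => i _ do rewrite mulrDr.
rewrite !big_split /= addrA; congr (_ + _).
by rewrite big_ord_recr [RHS]big_ord_recl /= bin_small // mul0r addr0 bin0.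
Qed.

Lemma sum_bin_widen (n d : nat) (F : nat -> R) :
  \sum_(k < (n + d).+1) 'C(n, k)%:R * F k
  = \sum_(k < n.+1) 'C(n, k)%:R * F k.
Proof.
rewrite -addSn big_split_ord /= [X in _ + X]big1 ?addr0 // => i _.
by rewrite bin_small ?mul0r //; lia.
Qed.

(** The [A]-th finite difference of a binomial coefficient lowers its lower index by [A]. The value
    C(B, i - A) is written with the complementary index [A + B - i] so that it vanishes when i <
    A. *)
Lemma sum_sign_bin_bin (A B i : nat) : (i <= A + B)%N ->
  \sum_(m < A.+1) 'C(A, m)%:R * ((-1) ^+ m * 'C(A + B - m, i)%:R)
  = 'C(B, A + B - i)%:R :> R.
Proof.
elim: A i => [|A IHA] i iAB.
  by rewrite big_ord1 /= mulr1n !mul1r subn0 bin_sub.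
rewrite (sum_binS _ (fun m => (-1) ^+ m * 'C(A.+1 + B - m, i)%:R)).
under eq_bigr => m _.
  rewrite addSn subSS subSn; last by have := ltn_ord m; lia.
  over.
case: i iAB => [|i] iAB.
  rewrite (@bin_small B); last by lia.
  by apply: big1 => m _; rewrite !bin0 exprS; ring.
rewrite addSn subSS -IHA; last by lia.
by apply: eq_bigr => m _; rewrite binS natrD exprS; ring.
Qed.

End Pascal.

(** * Pochhammer symbols and Chu-Vandermonde summation *)

Section Poch.
Variable F : fieldType.
Implicit Types a b c u v y z : F.

Lemma poch0 u : poch u 0 = 1. Proof. by rewrite /poch big_ord0. Qed.

Lemma pochSr u n : poch u n.+1 = poch u n * (u + n%:R).
Proof. by rewrite /poch big_ord_recr. Qed.

Lemma pochSl u n : poch u n.+1 = u * poch (u + 1) n.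
Proof.
rewrite (@poch_split _ u n.+1 1) // subn1 pochSr poch0.
by rewrite mul1r addr0.
Qed.

Lemma poch_diff u n :
  poch (u + 1) n.+1 - poch u n.+1 = n.+1%:R * poch (u + 1) n.
Proof. by rewrite pochSl -pochSl pochSr pochSl; ring. Qed.

Lemma poch_refl u n : poch (1 - u - n%:R) n = (-1) ^+ n * poch u n.
Proof.
elim: n u => [|n IHn] u; first by rewrite !poch0 mulr1.
rewrite pochSr pochSl.
have -> : 1 - u - n.+1%:R = 1 - (u + 1) - n%:R by ring.
by rewrite IHn exprS; ring.
Qed.

Lemma poch_oppn (n q : nat) : poch (- n%:R : F) q = (-1) ^+ q * (n ^_ q)%:R.
Proof.
elim: q => [|q IHq]; first by rewrite poch0 ffactn0 mul1r.
rewrite pochSr IHq ffactnSr natrM exprS.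
have [qn|nq] := leqP q n; first by rewrite natrB //; ring.
by rewrite ffact_small //; ring.
Qed.

(** Chu-Vandermonde free of denominators: Pascal's rule splits the sum in two, and [v] or [u]
    factors out of each half. *)
Lemma vandermonde u v n :
  \sum_(k < n.+1) 'C(n, k)%:R * (poch u k * poch v (n - k)) = poch (u + v) n.
Proof.
elim: n u v => [|n IHn] u v; first by rewrite big_ord1 !poch0 !mulr1.
rewrite (sum_binS _ (fun k => poch u k * poch v (n.+1 - k))).
under eq_bigr => k _.
  rewrite subSS subSn ?leq_ord // (pochSl u) (pochSl v) mulrDr addrC.
  rewrite -[u * _ * _]mulrA (mulrCA _ v) (mulrCA _ u) (mulrCA _ v).
  over.
rewrite big_split /= -!mulr_sumr !IHn pochSl.
by rewrite (addrAC u 1 v) (addrA u v 1) -mulrDl.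
Qed.

(** This is 2F1(-n, u; u + v; 1) = (v)_n / (u + v)_n multiplied out; reflecting Pochhammer symbols
    reduces it to [vandermonde]. *)
Lemma vandermonde_sub u v n :
  \sum_(i < n.+1)
     'C(n, i)%:R * ((-1) ^+ i * poch u i * poch (u + v + i%:R) (n - i))
  = poch v n.
Proof.
have H : poch v n = (-1) ^+ n * poch (u + (1 - (u + v) - n%:R)) n.
  have -> : u + (1 - (u + v) - n%:R) = 1 - v - n%:R by ring.
  by rewrite poch_refl mulrA -exprMn mulrNN mulr1 expr1n mul1r.
rewrite H -vandermonde mulr_sumr; apply: eq_bigr => -[i /= ilt] _.
have -> : 1 - (u + v) - n%:R = 1 - (u + v + i%:R) - (n - i)%:R.
  by rewrite natrB //; ring.
rewrite poch_refl -[in (-1) ^+ n](subnKC (ltnSE ilt)) exprD.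
set e := (-1) ^+ (n - i).
have : e * e = 1 by rewrite -expr2 sqrr_sign.
set B := 'C(n, i)%:R; set p := poch u i; set w := poch _ _; set s := (-1) ^+ i.
move=> ee; transitivity (e * e * (s * B * p * w)); last by ring.
by rewrite ee; ring.
Qed.

(** * Continuous dual Hahn polynomials over a field *)

(* [cdual_hahn] with [y] standing for i x and (-n)_i / i! written as a signed
   binomial, hence meaningful in any characteristic; [wil] is likewise
   [wilson]. *)
Definition cdh (n : nat) y a b c : F :=
  \sum_(i < n.+1) 'C(n, i)%:R * ((-1) ^+ i * (poch (a + y) i * poch (a - y) i)
    * (poch (a + b + i%:R) (n - i) * poch (a + c + i%:R) (n - i))).

Lemma cdh0 y a b c : cdh 0 y a b c = 1.
Proof. by rewrite /cdh big_ord1 !poch0 !mulr1. Qed.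

Lemma cdhCr n y a b c : cdh n y a b c = cdh n y a c b.
Proof.
by rewrite /cdh; apply: eq_bigr => i _; rewrite [_ * poch (a + c + _) _]mulrC.
Qed.

(* Expansion read off the generating function
   (1 - t)^(y - c) 2F1(a + y, b + y; a + b; t); it is symmetric in a and b. *)
Lemma cdh_expand n y a b c :
  cdh n y a b c = \sum_(k < n.+1) 'C(n, k)%:R *
    (poch (a + y) k * poch (b + y) k * poch (c - y) (n - k)
     * poch (a + b + k%:R) (n - k)).
Proof.
rewrite /cdh.
transitivity (\sum_(i < n.+1) \sum_(v < (n - i).+1)
   ('C(n, i) * 'C(n - i, v))%:R * ((-1) ^+ i * (poch (a + y) (i + v)
     * poch (a - y) i)
    * (poch (a + b + i%:R) (n - i) * poch (c - y) (n - (i + v))))).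
  apply: eq_bigr => i _.
  (* With this splitting, Chu-Vandermonde produces (a + y + i)_v, which merges with (a + y)_i into
     (a + y)_(i+v). *)
  have -> : a + c + i%:R = (a + y + i%:R) + (c - y) by ring.
  rewrite -(vandermonde (a + y + i%:R) (c - y)) !mulr_sumr.
  apply: eq_bigr => v _; rewrite subnDA (@poch_split _ (a + y) _ _ (leq_addr v i)) addKn natrM.
  by ring.
rewrite (@big_triangle _ _ (fun i v : nat => ('C(n, i) * 'C(n - i, v))%:R *
  ((-1) ^+ i * (poch (a + y) (i + v) * poch (a - y) i)
    * (poch (a + b + i%:R) (n - i) * poch (c - y) (n - (i + v)))))).
apply: eq_bigr => -[k /= klt] _; have kn : (k <= n)%N by [].
transitivity ('C(n, k)%:R * (poch (a + y) k * poch (c - y) (n - k)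
  * poch (a + b + k%:R) (n - k)) * poch (b + y) k); last by ring.
(* On the diagonal i + v = k, the sum over i is, up to factors free of i, a second Chu-Vandermonde
   sum with value (b + y)_k. *)
rewrite -(vandermonde_sub (a - y) (b + y)) mulr_sumr.
apply: eq_bigr => -[i /= ilt] _; have ik : (i <= k)%N by [].
rewrite mul_bin_bin // subnKC // natrM.
have -> : a - y + (b + y) + i%:R = a + b + i%:R by ring.
have H : (k - i <= n - i)%N by apply: leq_sub2r.
rewrite (poch_split _ H).
have -> : a + b + i%:R + (k - i)%:R = a + b + k%:R by rewrite natrB //; ring.
have -> : (n - i - (k - i) = n - k)%N by lia.
by ring.
Qed.

Lemma cdhCl n y a b c : cdh n y a b c = cdh n y b a c.
Proof.
rewrite !cdh_expand; apply: eq_bigr => k _.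
by rewrite [poch (a + y) k * _]mulrC [a + b]addrC.
Qed.

(** The top term is free of [c] and cancels; in the others the difference falls on (a + c +
    i)_(n+1-i) alone. *)
Lemma cdh_diff n y a b c :
  cdh n.+1 y a b (c + 1) - cdh n.+1 y a b c
  = n.+1%:R * (a + b + n%:R) * cdh n y a b (c + 1).
Proof.
rewrite /cdh -sumrB big_ord_recr /= !subnn !poch0 subrr addr0 mulr_sumr.
apply: eq_bigr => -[i /= ilt] _; have iN : (i <= n)%N by [].
rewrite subSn // (addrA a c 1) (addrAC _ 1) -mulrBr -mulrBr -mulrBr poch_diff.
rewrite pochSr.
have -> : a + b + i%:R + (n - i)%:R = a + b + n%:R by rewrite natrB //; ring.
have := mul_bin_down n.+1 i.
move=> /(congr1 (fun m => m%:R : F)); rewrite !natrM subSn // => H.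
transitivity (('C(n.+1, i)%:R * (n - i).+1%:R) *
 ((-1) ^+ i * (poch (a + y) i * poch (a - y) i) *
  (poch (a + b + i%:R) (n - i) * (a + b + n%:R) *
    poch (a + c + i%:R + 1) (n - i)))); first by ring.
by rewrite (mulrC 'C(n.+1, i)%:R) -H; ring.
Qed.


Lemma poch_opp_lt (m : nat) : poch (1 - m.+1%:R : F) m.+1 = 0.
Proof.
by have := poch_refl 0 m.+1; rewrite subr0 => ->; rewrite pochSl mul0r mulr0.
Qed.

(** * Dual Hahn weights *)

(** The part of the [q]-th term free of N and l, namely (a)_j (-j)_q (j + a + b - 1)_q / ((a)_q q!),
    written without division. *)
Definition dhcoef (j : nat) a b (q : nat) : F :=
  (-1) ^+ q * 'C(j, q)%:R * poch (j%:R + a + b - 1) q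
  * poch (a + q%:R) (j - q).

(* The weight C(N, l) (a)_j T_l(j; a - 1, b - 1, N), with the quotients
   (a)_j / (a)_q and C(N, l) (-l)_q / (-N)_q simplified away. *)
Definition dhweight (j : nat) a b (N l : nat) : F :=
  \sum_(q < j.+1) 'C(N - q, N - l)%:R * dhcoef j a b q.

(** The term ratio of the hypergeometric series, cleared of denominators. *)
Lemma dhcoefS (j : nat) a b (q : nat) : (q < j)%N ->
  q.+1%:R * (a + q%:R) * dhcoef j a b q.+1
  = (q%:R - j%:R) * (j%:R + a + b - 1 + q%:R) * dhcoef j a b q.
Proof.
move=> qj; rewrite /dhcoef.
have := mul_bin_left j q.
move=> /(congr1 (fun m => m%:R : F)); rewrite !natrM natrB 1?ltnW // => H.
have -> : (j - q)%N = (j - q.+1).+1 by rewrite subnSK.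
rewrite pochSr (pochSl (a + q%:R)) exprS.
have -> : a + q%:R + 1 = a + q.+1%:R by ring.
transitivity (- (q.+1%:R * 'C(j, q.+1)%:R) * ((-1) ^+ q * (a + q%:R) *
  (poch (j%:R + a + b - 1) q * (j%:R + a + b - 1 + q%:R))
  * poch (a + q.+1%:R) (j - q.+1))); first by ring.
by rewrite H; ring.
Qed.

Lemma mul_bin_downR (n m : nat) :
  n.+1%:R * 'C(n, m)%:R = (n.+1%:R - m%:R) * 'C(n.+1, m)%:R :> F.
Proof.
have [mn|nm] := leqP m n.+1; last by rewrite !bin_small ?mulr0 //; lia.
by rewrite -natrB // -!natrM -mul_bin_down.
Qed.

(** The contiguous relation that merges the two halves of the product rule in [conv_diff]. *)
Lemma dhweight_rec (j : nat) a b (N l : nat) : (j <= N.+1)%N -> (l <= N)%N ->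
  (N.+1 - l)%:R * (b + (N - l)%:R) * dhweight j a b N.+1 l
  + l.+1%:R * (a + l%:R) * dhweight j a b N.+1 l.+1
  = (N.+1%:R - j%:R) * (a + b + N%:R + j%:R) * dhweight j a b N l.
Proof.
move=> jN lN; rewrite /dhweight !mulr_sumr -big_split /= subSS.
rewrite (subSn lN); set M := (N - l)%N.
have lE : l%:R = N%:R - M%:R :> F by rewrite /M natrB //; ring.
pose A q := 'C(N - q, M)%:R : F.
(* Each term becomes a multiple of [A q] plus a remainder with the factor [q], which the term ratio
   absorbs after a shift of q. *)
transitivity (\sum_(q < j.+1)
   ((N.+1%:R - q%:R) * (a + b + N%:R + q%:R) * A q * dhcoef j a b q
    + q%:R * (a + q%:R - 1) * 'C(N.+1 - q, M)%:R * dhcoef j a b q)).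
  apply: eq_bigr => -[q /= qj] _.
  set f := dhcoef j a b q; have qN : (q <= N.+1)%N by lia.
  have e1 : (N.+1%:R - q%:R) * A q = M.+1%:R * 'C(N.+1 - q, M.+1)%:R.
    by rewrite -natrB // -!natrM -mul_bin_diag subSKn.
  have e2 : (N.+1%:R - q%:R) * A q
            = (N.+1%:R - q%:R - M%:R) * 'C(N.+1 - q, M)%:R.
    rewrite -natrB // /A; have [qN'|qN'] := leqP q N.
      by rewrite subSn // mul_bin_downR.
    (* Only [q = N.+1] remains, and there both sides are zero. *)
    have -> : (N.+1 - q = 0)%N by lia.
    by case: (M) => [|M']; rewrite ?bin0n /=; ring.
  transitivity ((M.+1%:R * 'C(N.+1 - q, M.+1)%:R) * (b + M%:R) * f
    + (l%:R + 1) * (a + l%:R) * 'C(N.+1 - q, M)%:R * f); first by ring.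
  rewrite -e1 lE.
  transitivity ((N.+1%:R - q%:R) * A q * ((b + M%:R) * f)
    + ((N.+1%:R - q%:R - M%:R) * 'C(N.+1 - q, M)%:R)
        * (a + N%:R - M%:R + q%:R) * f
    + q%:R * (a + q%:R - 1) * 'C(N.+1 - q, M)%:R * f); first by ring.
  by rewrite -e2; ring.
rewrite big_split /= [X in _ + X]big_ord_recl /= !mul0r add0r.
under [X in _ + X]eq_bigr => q _.
  rewrite /bump /= add1n subSS.
  have -> : q.+1%:R * (a + q.+1%:R - 1) * 'C(N - q, M)%:R * dhcoef j a b q.+1
    = A q * (q.+1%:R * (a + q%:R) * dhcoef j a b q.+1).
    by rewrite /A; ring.
  rewrite dhcoefS //; over.
(* The added term q = j is zero. Over equal ranges, the two coefficients of [A q] add up to a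
   quantity free of q. *)
have -> : \sum_(q < j) A q *
      ((q%:R - j%:R) * (j%:R + a + b - 1 + q%:R) * dhcoef j a b q)
  = \sum_(q < j.+1) A q *
      ((q%:R - j%:R) * (j%:R + a + b - 1 + q%:R) * dhcoef j a b q).
  by rewrite big_ord_recr /= subrr !mul0r mulr0 addr0.
rewrite -big_split /=; apply: eq_bigr => q _; rewrite -/(A q).
by ring.
Qed.

(** Terms with q < s vanish; putting q = s + v and reflecting (b + s)_(j-s) leaves the sum of
    [vandermonde_sub]. *)
Lemma sum_dhcoef (j : nat) a b (s : nat) :
  \sum_(q < j.+1) 'C(q, s)%:R * dhcoef j a b q
  = 'C(j, s)%:R * ((-1) ^+ j * poch (j%:R + a + b - 1) s
                   * poch (b + s%:R) (j - s)).
Proof.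
have [sj|js] := leqP s j; last first.
  rewrite bin_small // mul0r big1 // => q _.
  by rewrite bin_small ?mul0r //; have := ltn_ord q; lia.
have [d ->] : exists d, j = (s + d)%N by exists (j - s)%N; rewrite subnKC.
set J := (s + d)%N; rewrite /J -addnS big_split_ord /= big1 ?add0r; last first.
  by move=> q _; rewrite bin_small ?mul0r.
set S := J%:R + a + b - 1.
have R1 : poch (b + s%:R) d = (-1) ^+ d * poch (1 - b - J%:R) d.
  have -> : 1 - b - J%:R = 1 - (b + s%:R) - d%:R by rewrite /J; ring.
  by rewrite poch_refl mulrA -exprMn mulrNN mulr1 expr1n mul1r.
rewrite addKn R1 -(vandermonde_sub (S + s%:R) (1 - b - J%:R)) -/J !mulr_sumr.
apply: eq_bigr => -[v /= vd] _; have {}vd : (v <= d)%N by [].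
rewrite /dhcoef -/J -/S.
have -> : S + s%:R + (1 - b - J%:R) + v%:R = a + (s + v)%:R.
  by rewrite /S /J; ring.
have -> : (J - (s + v) = d - v)%N by rewrite /J; lia.
rewrite (@poch_split _ S _ _ (leq_addr v s)) addKn.
have B : 'C(J, s + v)%:R * 'C(s + v, s)%:R = 'C(J, s)%:R * 'C(d, v)%:R :> F.
  rewrite -!natrM -mul_bin_bin ?leq_addr //; last by rewrite /J leq_add2l.
  by rewrite /J !addKn.
have E : (-1) ^+ J * (-1) ^+ d = (-1) ^+ s :> F.
  by rewrite /J exprD -mulrA -expr2 sqrr_sign mulr1.
set p1 := poch S s; set p2 := poch _ v; set p3 := poch _ _.
transitivity (('C(J, s + v)%:R * 'C(s + v, s)%:R) *
   ((-1) ^+ s * ((-1) ^+ v * p1 * p2 * p3))); first by rewrite exprD; ring.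
by rewrite B -E; ring.
Qed.

(** The binomial inversion: after exchanging the sums, the alternating sum over l is C(q, N - i) by
    [sum_sign_bin_bin], and [sum_dhcoef] evaluates the rest. *)
Lemma dhweight_moment (j : nat) a b (N i : nat) : (j <= N)%N -> (i <= N)%N ->
  \sum_(l < N.+1) (-1) ^+ (N - l) * 'C(l, i)%:R * dhweight j a b N l
  = 'C(j, N - i)%:R * ((-1) ^+ j * poch (j%:R + a + b - 1) (N - i)
                       * poch (b + (N - i)%:R) (j - (N - i))).
Proof.
move=> jN iN; rewrite -sum_dhcoef.
under eq_bigr => l _ do rewrite /dhweight mulr_sumr.
rewrite exchange_big; apply: eq_bigr => -[q /= qj] _.
have qN : (N - q + q = N)%N by apply: subnK; lia.
have -> : (N - i = N - q + q - i)%N by rewrite qN.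
rewrite -sum_sign_bin_bin; last by rewrite qN.
have := sum_bin_widen (N - q) q (fun m => (-1) ^+ m * 'C(N - m, i)%:R : F).
rewrite qN => <-; rewrite mulr_suml (reindex_inj rev_ord_inj) /=.
apply: eq_bigr => -[l /= lN] _.
have -> : (N - (N.+1 - l.+1))%N = l by lia.
by rewrite subSS; ring.
Qed.

(** * The convolution identity over a field *)

Definition wil (n : nat) y a b c d : F :=
  \sum_(i < n.+1) 'C(n, i)%:R *
    ((-1) ^+ i * poch (n%:R + a + b + c + d - 1) i
     * (poch (a + y) i * poch (a - y) i)
     * (poch (a + b + i%:R) (n - i) * poch (a + c + i%:R) (n - i)
        * poch (a + d + i%:R) (n - i))).

(** The left hand side, with [y], [z] for i rho, i tau, [k] for k1, and [a + b] equal to 2 k2. The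
    parameter [c], which is k3 - k2 + r + 1/2 in the theorem, stays free so that it can be shifted
    by 1. *)
Definition conv (j N : nat) y z a b k c : F :=
  \sum_(l < N.+1) dhweight j (k + k) (a + b) N l
    * cdh (N - l) y a b (c + l%:R) * cdh l z (k + y) (k - y) (c - k).

Lemma conv_diff j N y z a b k c : (j <= N.+1)%N ->
  conv j N.+1 y z a b k (c + 1) - conv j N.+1 y z a b k c
  = (N.+1%:R - j%:R) * (k + k + (a + b) + N%:R + j%:R)
    * conv j N y z a b k (c + 1).
Proof.
move=> jN; rewrite /conv -sumrB.
pose w l := dhweight j (k + k) (a + b) N.+1 l.
pose S l c := cdh (N.+1 - l) y a b (c + l%:R).
pose T l c := cdh l z (k + y) (k - y) (c - k).
(* Discrete product rule. Taking [T] at [c + 1] in the first sum and [S] at [c] in the second yields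
   the same products in both, since c + (l + 1) = (c + 1) + l. *)
transitivity (\sum_(l < N.+2) w l * (S l (c + 1) - S l c) * T l (c + 1)
  + \sum_(l < N.+2) w l * S l c * (T l (c + 1) - T l c)).
  by rewrite -big_split; apply: eq_bigr => l _; rewrite /w /S /T /=; ring.
(* The end terms drop out, as [S N.+1] and [T 0] have degree 0 and do not depend on c. *)
rewrite big_ord_recr [X in _ + X]big_ord_recl /=.
have S1 c' : S N.+1 c' = 1 by rewrite /S subnn cdh0.
have T1 c' : T 0 c' = 1 by rewrite /T cdh0.
rewrite !S1 !T1 !subrr !mulr0 mul0r addr0 add0r.
rewrite -big_split mulr_sumr; apply: eq_bigr => -[l /= lN] _.
rewrite /bump /= add1n.
have {}lN : (l <= N)%N by [].
have -> : S l (c + 1) - S l c = (N.+1 - l)%:R * (a + b + (N - l)%:R)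
            * cdh (N - l) y a b (c + 1 + l%:R).
  by rewrite /S subSn // (addrAC c 1) cdh_diff.
have -> : T l.+1 (c + 1) - T l.+1 c = l.+1%:R * (k + k + l%:R) * T l (c + 1).
  rewrite /T (addrAC c 1) cdh_diff.
  by have -> : k + y + (k - y) = k + k by ring.
have -> : S l.+1 c = cdh (N - l) y a b (c + 1 + l%:R).
  by rewrite /S subSS; congr cdh; ring.
set X := cdh _ _ _ _ _.
transitivity (((N.+1 - l)%:R * (a + b + (N - l)%:R) * w l
  + l.+1%:R * (k + k + l%:R) * w l.+1) * (X * T l (c + 1))); first by ring.
by rewrite dhweight_rec // /T; ring.
Qed.

(** For i < n the last factor of (a + c + i)_(n-i) is zero, so only the top term survives. *)
Lemma cdh_truncated (n : nat) y a b c : a + c = 1 - n%:R ->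
  cdh n y a b c = (-1) ^+ n * (poch (a + y) n * poch (a - y) n).
Proof.
move=> ac; rewrite /cdh big_ord_recr /= big1 ?add0r.
  by rewrite binn subnn !poch0; ring.
move=> -[i /= ilt] _; rewrite ac.
have -> : 1 - n%:R + i%:R = 1 - (n - i.+1).+1%:R :> F.
  by rewrite subnSK // natrB ?(ltnW ilt) //; ring.
by rewrite -(subnSK ilt) poch_opp_lt !mulr0.
Qed.

Lemma poch_refl_split u (m n : nat) : (m <= n)%N ->
  poch u n = (-1) ^+ (n - m) * poch u m * poch (1 - u - n%:R) (n - m).
Proof.
move=> mn; rewrite (@poch_split _ u n m) //.
have -> : 1 - u - n%:R = 1 - (u + m%:R) - (n - m)%:R :> F.
  by rewrite natrB //; ring.
by rewrite poch_refl mulrACA mulrA -expr2 sqrr_sign mul1r.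
Qed.

Lemma conv_base (j n : nat) y z a b k :
  let c := 1 - a - (n + j)%:R in
  conv j (n + j) y z a b k c
  = wil j y a b (k + z) (k - z) * cdh n z (k + a + j%:R) (k + b + j%:R) (c - k).
Proof.
move=> c; set N := (n + j)%N; have jN : (j <= N)%N by apply: leq_addl.
rewrite /conv (@cdh_truncated n); last by rewrite /c natrD; ring.
(* With S_l expanded from its third parameter, its [i]-th term times the product for S_(N-l) depends
   on l only through a sign and C(l, i); [P (N - i)] is the common part. *)
pose P s := poch (a + y) s * poch (a - y) s
  * (poch (a + k + s%:R + z) (N - s) * poch (a + k + s%:R - z) (N - s)).
transitivity (\sum_(l < N.+1) \sum_(i < N.+1)
  (-1) ^+ i * P (N - i)%N *
   ((-1) ^+ (N - l) * 'C(l, i)%:R * dhweight j (k + k) (a + b) N l)).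
  apply: eq_bigr => -[l /= llt] _; have lN : (l <= N)%N by [].
  rewrite cdh_truncated; last by rewrite natrB // /c -/N; ring.
  rewrite cdhCr cdhCl /cdh.
  have -> : \sum_(i < N.+1) (-1) ^+ i * P (N - i)%N *
     ((-1) ^+ (N - l) * 'C(l, i)%:R * dhweight j (k + k) (a + b) N l)
    = \sum_(i < (l + (N - l)).+1) 'C(l, i)%:R * ((-1) ^+ i * P (N - i)%N *
     ((-1) ^+ (N - l) * dhweight j (k + k) (a + b) N l)).
    by rewrite subnKC //; apply: eq_bigr => i _; ring.
  rewrite (sum_bin_widen _ _ (fun i => (-1) ^+ i * P (N - i)%N *
     ((-1) ^+ (N - l) * dhweight j (k + k) (a + b) N l))).
  rewrite mulr_sumr; apply: eq_bigr => -[i /= ilt] _.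
  have il : (i <= l)%N by [].
  have H : (N - l <= N - i)%N by apply: leq_sub2l.
  have E : (N - i - (N - l) = l - i)%N by lia.
  have iN : (i <= N)%N := leq_trans il lN.
  have e1 u : poch (a + u) (N - i)
    = (-1) ^+ (l - i) * poch (a + u) (N - l) * poch (c - u + i%:R) (l - i).
    rewrite (poch_refl_split _ H) E; congr (_ * poch _ _).
    by rewrite natrB // /c -/N; ring.
  have e2 u : poch (a + k + (N - i)%:R + u) i
    = (-1) ^+ i * poch (c - k - u) i.
    have -> : c - k - u = 1 - (a + k + (N - i)%:R + u) - i%:R.
      by rewrite natrB // /c -/N; ring.
    by rewrite poch_refl mulrA -expr2 sqrr_sign mul1r.
  have -> : c - k + (k - y) + i%:R = c - y + i%:R by ring.
  have -> : c - k + (k + y) + i%:R = c + y + i%:R by ring.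
  rewrite /P (subKn iN) !e1 !e2 !opprK.
  set D := dhweight _ _ _ _ _.
  have s1 := sqrr_sign F i; have s2 := sqrr_sign F (l - i).
  set p1 := poch (a + y) _; set p2 := poch (a - y) _.
  set p3 := poch (c - y + _) _; set p4 := poch (c + y + _) _.
  set p5 := poch (c - k + z) _; set p6 := poch (c - k - z) _.
  transitivity (((-1) ^+ i) ^+ 2 * ((-1) ^+ (l - i)) ^+ 2 *
    (D * (-1) ^+ (N - l) * p1 * p2 * 'C(l, i)%:R * (-1) ^+ i
     * p3 * p4 * p5 * p6)).
    by rewrite s1 s2; ring.
  by ring.
rewrite exchange_big /=.
under eq_bigr => i _ do rewrite -mulr_sumr dhweight_moment ?leq_ord //.
(* With s = N - i the moment carries C(j, s), which cuts the sum down to s <= j, the range of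
   W_j. *)
rewrite (reindex_inj rev_ord_inj) /=.
pose G s := (-1) ^+ n * (-1) ^+ s * P s * poch (j%:R + (k + k) + (a + b) - 1) s
  * poch (a + b + s%:R) (j - s).
transitivity (\sum_(s < (j + n).+1) 'C(j, s)%:R * G s).
  have -> : (j + n)%N = N by rewrite addnC.
  apply: eq_bigr => -[s /= slt] _; have sN : (s <= N)%N by [].
  rewrite subSS (subKn sN) /G.
  have : (-1) ^+ (N - s) * (-1) ^+ j = (-1) ^+ n * (-1) ^+ s :> F.
    have eN : (-1) ^+ (N - s) * (-1) ^+ s = (-1) ^+ n * (-1) ^+ j :> F.
      by rewrite -!exprD subnK.
    move: eN (sqrr_sign F s) (sqrr_sign F j).
    move: ((-1) ^+ s) ((-1) ^+ j) ((-1) ^+ (N - s)) ((-1) ^+ n) => v w u x.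
    move=> e1 e2 e3; rewrite -[u]mulr1 -e2 expr2 mulrA e1.
    by rewrite -[RHS]mulr1 -e3; ring.
  set u := (-1) ^+ (N - s); set v := (-1) ^+ j => e.
  transitivity (u * v * ('C(j, s)%:R * P s
    * poch (j%:R + (k + k) + (a + b) - 1) s * poch (a + b + s%:R) (j - s))).
    by ring.
  by rewrite e; ring.
rewrite sum_bin_widen /wil mulr_suml.
apply: eq_bigr => -[s /= slt] _; have sj : (s <= j)%N by [].
have -> : j%:R + a + b + (k + z) + (k - z) - 1
        = j%:R + (k + k) + (a + b) - 1 by ring.
rewrite /G /P.
(* For u = z and u = -z, splitting off the last n factors isolates the product to which S_n
   reduces. *)
have e u : poch (a + k + s%:R + u) (N - s)
  = poch (a + (k + u) + s%:R) (j - s) * poch (k + a + j%:R + u) n.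
  have H : (j - s <= N - s)%N by apply: leq_sub2r.
  rewrite (@poch_split _ _ _ _ H).
  have -> : (N - s - (j - s) = n)%N by rewrite /N; lia.
  by congr (poch _ _ * poch _ _); rewrite ?natrB //; ring.
rewrite !e; ring.
Qed.

(** The factor N + 1 - j of [conv_diff] vanishes at N = j - 1. This settles n = 0, where S_n is
    1. *)
Lemma conv_shift0 (j : nat) y z a b k c :
  conv j j y z a b k (c + 1) = conv j j y z a b k c.
Proof.
case: j => [|j]; first by rewrite /conv !big_ord1 !cdh0.
by apply/eqP; rewrite -subr_eq0 conv_diff // subrr !mul0r.
Qed.

Lemma int_shift_const (g : int -> F) : (forall m, g (m + 1) = g m) ->
  forall r s, g r = g s.
Proof.
move=> gS; have gD m (p : nat) : g (m + p%:Z) = g m.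
  elim: p => [|p IHp]; first by rewrite addr0.
  by rewrite -IHp -[in RHS]gS -addrA -[p.+1%:Z]/(Posz p.+1) -addn1.
move=> r s; rewrite -(subrK s r) addrC; case: (r - s) => p; first exact: gD.
by rewrite -(gD (s + Negz p) p.+1) NegzE subrK.
Qed.

Lemma conv_wil (j n : nat) y z a b k (r : int) :
  let c := 1 - a + r%:~R in
  conv j (n + j) y z a b k c
  = wil j y a b (k + z) (k - z) * cdh n z (k + a + j%:R) (k + b + j%:R) (c - k).
Proof.
pose f n r := conv j (n + j) y z a b k (1 - a + r%:~R) -
  wil j y a b (k + z) (k - z)
  * cdh n z (k + a + j%:R) (k + b + j%:R) (1 - a + r%:~R - k).
suff H : f n r = 0 by apply/eqP; rewrite -subr_eq0; apply/eqP.
have base m : f m (- (m + j)%:Z) = 0.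
  by rewrite /f mulrNz conv_base subrr.
elim: n r => [|n IHn] r.
  rewrite -[RHS](base 0%N); apply: int_shift_const => m.
  by rewrite /f !cdh0 intrD addrA conv_shift0.
rewrite -[RHS](base n.+1); apply: int_shift_const => m; apply/eqP; rewrite -subr_eq0.
have := IHn (m + 1); rewrite /f intrD addrA.
set c := 1 - a + m%:~R.
have <- : c - k + 1 = c + 1 - k by ring.
set x1 := conv _ _ _ _ _ _ _ _; set x2 := cdh n _ _ _ _.
(* As (n + j + 1) - j = n + 1, both differences carry the multiplier (n + 1) (2 k + a + b + n + 2
   j), so the increment of [f n.+1] is a multiple of [f n (m + 1)], which is zero. *)
have : conv j (n.+1 + j) y z a b k (c + 1) - conv j (n.+1 + j) y z a b k c
  = ((n + j).+1%:R - j%:R) * (k + k + (a + b) + (n + j)%:R + j%:R) * x1.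
  by rewrite -conv_diff // leqW // leq_addl.
have := cdh_diff n z (k + a + j%:R) (k + b + j%:R) (c - k).
rewrite -/x2 => e1 e2 e3.
set c1 := conv _ _ _ _ _ _ _ _ in e2 *.
set c2 := conv _ _ _ _ _ _ _ _ in e2 *.
set d1 := cdh _ _ _ _ _ in e1 *.
set d2 := cdh n.+1 _ _ _ _ in e1 *.
set w := wil _ _ _ _ _ _ in e3 *.
have -> : c1 - w * d1 - (c2 - w * d2) = (c1 - c2) - w * (d1 - d2) by ring.
rewrite e1 e2 -[x1](subrK (w * x2)) e3; apply/eqP; ring.
Qed.

End Poch.

(** * Return to the hypergeometric definitions *)

Lemma poch_oppn_fact (C : numFieldType) (n i : nat) :
  poch (- n%:R : C) i / i`!%:R = (-1) ^+ i * 'C(n, i)%:R.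
Proof.
rewrite poch_oppn -bin_ffact natrM mulrA mulfK //.
by rewrite pnatr_eq0 -lt0n fact_gt0.
Qed.

Lemma cdual_hahnE (C : numClosedFieldType) n (x a b c : C) :
  cdual_hahn n x a b c = cdh n ('i * x) a b c.
Proof.
apply: eq_bigr => i _.
transitivity (poch (- n%:R : C) i / i`!%:R *
  (poch (a + 'i * x) i * poch (a - 'i * x) i
   * (poch (a + b + i%:R) (n - i) * poch (a + c + i%:R) (n - i)))).
  by ring.
by rewrite poch_oppn_fact; ring.
Qed.

Lemma wilsonE (C : numClosedFieldType) n (x a b c d : C) :
  wilson n x a b c d = wil n ('i * x) a b c d.
Proof.
apply: eq_bigr => i _.
transitivity (poch (- n%:R : C) i / i`!%:R *
  (poch (n%:R + a + b + c + d - 1) i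
     * (poch (a + 'i * x) i * poch (a - 'i * x) i)
     * (poch (a + b + i%:R) (n - i) * poch (a + c + i%:R) (n - i)
        * poch (a + d + i%:R) (n - i)))); first by ring.
by rewrite poch_oppn_fact; ring.
Qed.

(** Since (-l)_q vanishes for q > l, the sum up to min(l, j) may run up to j; as (a)_j is nonzero,
    (a)_j / (a)_q becomes (a + q)_(j-q). *)
Lemma dual_hahnE (C : numFieldType) (j l N : nat) (a b : C) :
  (j <= N)%N -> (l <= N)%N -> poch a j != 0 ->
  'C(N, l)%:R * poch a j * dual_hahn l j (a - 1) (b - 1) N
  = dhweight j a b N l.
Proof.
move=> jN lN a0; rewrite /dual_hahn /hypergeom /dhweight subrK.
have -> : j%:R + (a - 1) + (b - 1) + 1 = j%:R + a + b - 1 by ring.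
pose G q := poch (- l%:R : C) q * poch (- j%:R : C) q
  * poch (j%:R + a + b - 1) q / (poch a q * poch (- N%:R : C) q) / q`!%:R.
transitivity ('C(N, l)%:R * poch a j * \sum_(q < j.+1) G q).
  congr (_ * _).
  have -> : \sum_(q < j.+1) G q = \sum_(q < (minn l j).+1 + (j - minn l j)) G q.
    by rewrite addSn subnKC ?geq_minr.
  rewrite [RHS]big_split_ord /= [X in _ = _ + X]big1 ?addr0.
    apply: eq_bigr => q _.
    by rewrite /G !big_cons !big_nil !mulr1 expr1n mul1r !mulrA.
  move=> q _; rewrite /G poch_oppn ffact_small ?mulr0 ?mul0r //.
  by have := ltn_ord q; lia.
rewrite mulr_sumr; apply: eq_bigr => -[q /= qlt] _; have qj : (q <= j)%N by [].
have qN := leq_trans qj jN.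
have B : 'C(N, l)%:R * poch (- l%:R : C) q / poch (- N%:R) q
         = 'C(N - q, N - l)%:R.
  have nz : poch (- N%:R : C) q != 0.
    by rewrite poch_oppn mulf_neq0 ?signr_eq0 // pnatr_eq0 -lt0n ffact_gt0.
  apply: (mulIf nz); rewrite mulfVK // !poch_oppn mulrCA -natrM.
  by rewrite ffact_mul_bin // natrM; ring.
rewrite /dhcoef (poch_ratio a0 qj) -B /G -poch_oppn_fact invfM.
by ring.
Qed.

Theorem theorem7p1 (R : realType) (k1 k2 k3 : R)
    (hk1 : 0 < k1) (hk2 : 0 < k2) (hk3 : 0 < k3)
    (n j : nat) (r : int) (rho tau : R) :
  let K1 : R[i] := k1%:C in
  let K2 : R[i] := k2%:C in
  let K3 : R[i] := k3%:C in
  let x : R[i] := rho%:C in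
  let t : R[i] := tau%:C in
  let I : R[i] := ('i)%R in
  let h : R[i] := 2%:R^-1 in
  \sum_(l < (n + j).+1)
     'C(n + j, l)%:R * poch (2%:R * K1) j
     * dual_hahn l j (2%:R * K1 - 1) (2%:R * K2 - 1) (n + j)
     * cdual_hahn (n + j - l) x
         (K2 - K3 + h) (K2 + K3 - h) (K3 - K2 + l%:R + r%:~R + h)
     * cdual_hahn l t
         (K1 + I * x) (K1 - I * x) (K3 - K2 - K1 + r%:~R + h)
  = wilson j x (K2 - K3 + h) (K2 + K3 - h) (K1 + I * t) (K1 - I * t)
    * cdual_hahn n t
        (K1 + K2 - K3 + j%:R + h) (K1 + K2 + K3 + j%:R - h)
        (K3 - K2 - K1 + r%:~R + h).
Proof.
move=> K1 K2 K3 x t I h.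
set a := K2 - K3 + h; set b := K2 + K3 - h.
have hh : h + h = 1.
  by rewrite -mulr2n -mulr_natl mulfV // pnatr_eq0.
(* Positivity of k1 makes every factor positive, so the lower parameter 2 k1 of T_l causes no
   division by zero. *)
have nz : poch (2%:R * K1) j != 0.
  have K1_gt0 : 0 < K1 by rewrite ltcR.
  rewrite /poch; apply/prodf_neq0 => i _; apply: lt0r_neq0.
  by apply: ltr_pwDl; rewrite ?ler0n // mulr_gt0 // ltr0n.
have := conv_wil j n (I * x) (I * t) a b K1 r.
have -> : 1 - a + r%:~R = K3 - K2 + r%:~R + h by rewrite /a -hh; ring.
have cE : K3 - K2 + r%:~R + h - K1 = K3 - K2 - K1 + r%:~R + h by ring.
rewrite /= wilsonE cdual_hahnE cE.
have -> : K1 + K2 - K3 + j%:R + h = K1 + a + j%:R by rewrite /a; ring.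
have -> : K1 + K2 + K3 + j%:R - h = K1 + b + j%:R by rewrite /b; ring.
move=> <-; apply: eq_bigr => l _.
have e2 (u : R[i]) : 2%:R * u = u + u by rewrite mulr_natl mulr2n.
have abE : a + b = 2%:R * K2 by rewrite /a /b; ring.
rewrite dual_hahnE ?leq_addl ?leq_ord // !cdual_hahnE cE abE e2.
by congr (_ * cdh _ _ _ _ _ * _); ring.
Qed.
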